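(* For the $T^2$-action on the nearly Kähler complex projective space $\mathbb{CP}^3=\mathrm{Sp}(2)/\mathrm{Sp}(1)\mathrm{U}(1)$ with multi-moment map $\nu_{\mathbb{CP}^3}$ described in the context, the orbit space $\nu_{\mathbb{CP}^3}^{-1}(0)/T^2$ can be identified with (i.e. is homeomorphic to) $\mathbb{RP}^3/\mathbb{Z}_2^2$.
   Context: $\mathrm{Sp}(2)$ is the group of $2\times2$ quaternionic matrices $p$ with $p^{-1}=\overline{p}^{t}$; $\mathrm{Sp}(1)\mathrm{U}(1)\subset\mathrm{Sp}(2)$ is the subgroup of matrices $\mathrm{diag}(e^{i\vartheta},\alpha)$ with $\alpha$ a unit quaternion, and $\mathbb{CP}^3\cong\mathrm{Sp}(2)/\mathrm{Sp}(1)\mathrm{U}(1)$ (from the transitive action of $\mathrm{Sp}(2)$ on $\mathbb{CP}^3$ induced by $\mathbb{C}^4\cong\mathbb{H}^2$). Nearly Kähler structure: $\mathfrak{sp}(2)=\mathfrak{h}\oplus\mathfrak{m}$, with $\mathfrak{h}$ the Lie algebra of $\mathrm{Sp}(1)\mathrm{U}(1)$ and $\mathfrak{m}$ the matrices $\begin{pmatrix} xj & \rho\\ -\overline{\rho} & 0\end{pmatrix}$, $x\in\mathbb{C}$, $\rho\in\mathbb{H}$. On $\mathfrak{m}$ put $g_0(X,Y)=\mathrm{Re}\,\mathrm{Tr}(\overline{X}^{t}Y)$, $J_0X=\tfrac{2}{\sqrt3}\bigl(AXA^{-1}+\tfrac12X\bigr)$ with $A=\mathrm{diag}(e^{2\pi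 i/3},1)$, and $\sigma_0=g_0(J_0\cdot,\cdot)$; these are extended by left translation to $\mathrm{Sp}(2)$-invariant tensors on $\mathrm{Sp}(2)/\mathrm{Sp}(1)\mathrm{U}(1)$. The torus $T^2=\{\mathrm{diag}(e^{i\vartheta},e^{i\varphi})\}\subset\mathrm{Sp}(2)$ acts by left multiplication; on $\mathbb{CP}^3$ it acts as $[z^1:z^2:z^3:z^4]\mapsto[e^{i\vartheta}z^1:e^{i\varphi}z^2:e^{-i\vartheta}z^3:e^{-i\varphi}z^4]$. The action has kernel $\{\pm\mathrm{Id}\}\cong\mathbb{Z}_2$, and $T^2/\mathbb{Z}_2\cong T^2$ acts effectively. With $U=\mathrm{diag}(i,0)$, $V=\mathrm{diag}(0,i)$, the multi-moment map at the coset of $p$ is $\nu_{\mathbb{CP}^3}(p)=\sigma_0\bigl((p^{-1}Up)_{\mathfrak{m}},(p^{-1}Vp)_{\mathfrak{m}}\bigr)$ (subscript $\mathfrak{m}$: projection onto $\mathfrak{m}$). Writing $p_{ik}=p_{ik}^1+p_{ik}^2j$ with $p_{ik}^1,p_{ik}^2\in\mathbb{C}$, it equals $12\,\mathrm{Im}(\overline{p}_{11}^1p_{11}^2p_{21}^1\overline{p}_{21}^2)$. $\mathbb{Z}_2^2$ is the real part of the effectively acting torus $T^2/\mathbb{Z}_2\cong T^2$ (its subgroup of elements of order at most two). It acts on $\mathbb{RP}^3$ by changing the sign of an even number of homogeneous coordinates, i.e. it is generated by $[z^1:z^2:z^3:z^4]\mapsto[z^1:-z^2:z^3:-z^4]$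 and $[z^1:z^2:z^3:z^4]\mapsto[z^1:z^2:-z^3:-z^4]$. *)

(* Defs.v *)
From HB Require Import structures.
From mathcomp Require Import all_boot all_order all_algebra.
From mathcomp Require Import ring.
From mathcomp Require Import all_classical all_reals all_analysis.

Set Implicit Arguments.
Unset Strict Implicit.
Unset Printing Implicit Defensive.
Import Order.TTheory GRing.Theory Num.Theory.
Import numFieldNormedType.Exports.
Local Open Scope classical_set_scope.
Local Open Scope ring_scope.
Local Open Scope quotient_scope.

Definition homeomorphic (X Y : topologicalType) : Prop :=
  exists (f : X -> Y) (g : Y -> X),
    [/\ continuous f, continuous g, cancel f g & cancel g f].

Definition mk_sub (T : Type) (A : set T) (x : T) (Ax : A x) : A :=
  exist (fun y => y \in A) x (mem_set Ax).

(* Quat a b c d is a + b i + c j + d k = (a + b i) + (c + d i) j; the subfield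
   of complex numbers is {c = d = 0}. *)
Record quat (R : realType) : Type := Quat { qr : R; qi : R; qj : R; qk : R }.

Definition quat_coords (R : realType) (x : quat R) : R * R * R * R :=
  (qr x, qi x, qj x, qk x).
Definition quat_of_coords (R : realType) (v : R * R * R * R) : quat R :=
  Quat v.1.1.1 v.1.1.2 v.1.2 v.2.
Lemma quat_coordsK (R : realType) :
  cancel (@quat_coords R) (@quat_of_coords R).
Proof. by case. Qed.

HB.instance Definition _ (R : realType) :=
  Choice.copy (quat R) (can_type (@quat_coordsK R)).

Definition quat_add (R : realType) (x y : quat R) : quat R :=
  Quat (qr x + qr y) (qi x + qi y) (qj x + qj y) (qk x + qk y).
Definition quat_opp (R : realType) (x : quat R) : quat R :=
  Quat (- qr x) (- qi x) (- qj x) (- qk x).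
Definition quat_mul (R : realType) (x y : quat R) : quat R :=
  Quat (qr x * qr y - qi x * qi y - qj x * qj y - qk x * qk y)
       (qr x * qi y + qi x * qr y + qj x * qk y - qk x * qj y)
       (qr x * qj y - qi x * qk y + qj x * qr y + qk x * qi y)
       (qr x * qk y + qi x * qj y - qj x * qi y + qk x * qr y).

Lemma quat_eqP (R : realType) (x y : quat R) :
  qr x = qr y -> qi x = qi y -> qj x = qj y -> qk x = qk y -> x = y.
Proof. by case: x => ????; case: y => ???? /= -> -> -> ->. Qed.

Fact quat_addA (R : realType) : associative (@quat_add R).
Proof. by move=> x y z; apply: quat_eqP => /=; ring. Qed.
Fact quat_addC (R : realType) : commutative (@quat_add R).
Proof. by move=> x y; apply: quat_eqP => /=; ring. Qed.
Fact quat_add0 (R : realType) : left_id (Quat 0 0 0 0) (@quat_add R).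
Proof. by move=> x; apply: quat_eqP => /=; ring. Qed.
Fact quat_addN (R : realType) :
  left_inverse (Quat 0 0 0 0) (@quat_opp R) (@quat_add R).
Proof. by move=> x; apply: quat_eqP => /=; ring. Qed.

HB.instance Definition _ (R : realType) :=
  GRing.isZmodule.Build (quat R) (@quat_addA R) (@quat_addC R)
    (@quat_add0 R) (@quat_addN R).

Fact quat_mulA (R : realType) : associative (@quat_mul R).
Proof. by move=> x y z; apply: quat_eqP => /=; ring. Qed.
Fact quat_mul1 (R : realType) : left_id (Quat 1 0 0 0) (@quat_mul R).
Proof. by move=> x; apply: quat_eqP => /=; ring. Qed.
Fact quat_mulr1 (R : realType) : right_id (Quat 1 0 0 0) (@quat_mul R).
Proof. by move=> x; apply: quat_eqP => /=; ring. Qed.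
Fact quat_mulDl (R : realType) : left_distributive (@quat_mul R) +%R.
Proof. by move=> x y z; apply: quat_eqP => /=; ring. Qed.
Fact quat_mulDr (R : realType) : right_distributive (@quat_mul R) +%R.
Proof. by move=> x y z; apply: quat_eqP => /=; ring. Qed.
Fact quat_oner_neq0 (R : realType) : Quat 1 0 0 0 != 0 :> quat R.
Proof. by apply/eqP => -[/eqP]; rewrite oner_eq0. Qed.

HB.instance Definition _ (R : realType) :=
  GRing.Zmodule_isNzRing.Build (quat R) (@quat_mulA R) (@quat_mul1 R)
    (@quat_mulr1 R) (@quat_mulDl R) (@quat_mulDr R) (@quat_oner_neq0 R).

HB.instance Definition _ (R : realType) :=
  Topological.copy (quat R) (initial_topology (@quat_coords R)).

Definition quat_real (R : realType) (c : R) : quat R := Quat c 0 0 0.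
Definition quat_cpx (R : realType) (a b : R) : quat R := Quat a b 0 0.
Definition quat_j (R : realType) : quat R := Quat 0 0 1 0.
Definition quat_conj (R : realType) (x : quat R) : quat R :=
  Quat (qr x) (- qi x) (- qj x) (- qk x).
Definition quat_expi (R : realType) (t : R) : quat R :=
  quat_cpx (cos t) (sin t).

Definition mx2 (R : realType) (a b c d : quat R) : 'M[quat R]_2 :=
  \matrix_(i, j) if i == 0 then (if j == 0 then a else b)
                 else (if j == 0 then c else d).
Definition dg2 (R : realType) (a b : quat R) : 'M[quat R]_2 := mx2 a 0 0 b.

Definition adj (R : realType) (p : 'M[quat R]_2) : 'M[quat R]_2 :=
  map_mx (@quat_conj R) p^T.

(* p is invertible with inverse adj p *)
Definition Sp2 (R : realType) : set 'M[quat R]_2 :=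
  [set p | p *m adj p = 1%:M /\ adj p *m p = 1%:M].
Arguments Sp2 : clear implicits.

Section Algebra.
Context {R : realType}.
Implicit Types (p q h t X Y : 'M[quat R]_2) (x y : quat R).

Lemma quat_conjM x y : quat_conj (x * y) = quat_conj y * quat_conj x.
Proof. by apply: quat_eqP => /=; ring. Qed.
Lemma quat_conjD x y : quat_conj (x + y) = quat_conj x + quat_conj y.
Proof. by apply: quat_eqP => /=; ring. Qed.
Lemma quat_conjK x : quat_conj (quat_conj x) = x.
Proof. by apply: quat_eqP => /=; ring. Qed.
Lemma quat_conj0 : quat_conj 0 = 0 :> quat R.
Proof. by apply: quat_eqP => /=; ring. Qed.
Lemma quat_conj1 : quat_conj 1 = 1 :> quat R.
Proof. by apply: quat_eqP => /=; ring. Qed.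

Lemma quat_conj_unit x : x * quat_conj x = 1 -> quat_conj x * x = 1.
Proof.
move=> [e _ _ _]; apply: quat_eqP => /=; try by ring.
by rewrite -e /=; ring.
Qed.

Lemma quat_expi_unit (t : R) : quat_expi t * quat_conj (quat_expi t) = 1.
Proof.
apply: quat_eqP => /=; try by ring.
by rewrite -[RHS](cos2Dsin2 t); ring.
Qed.
Lemma quat_expiD (s t : R) : quat_expi (s + t) = quat_expi s * quat_expi t.
Proof. by apply: quat_eqP => /=; rewrite ?cosD ?sinD; ring. Qed.
Lemma quat_expiN (t : R) : quat_expi (- t) = quat_conj (quat_expi t).
Proof. by apply: quat_eqP => /=; rewrite ?cosN ?sinN; ring. Qed.
Lemma quat_expi0 : quat_expi 0 = 1 :> quat R.
Proof. by apply: quat_eqP => /=; rewrite ?cos0 ?sin0. Qed.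


Lemma mx2P X Y : X 0 0 = Y 0 0 -> X 0 1 = Y 0 1 -> X 1 0 = Y 1 0 ->
  X 1 1 = Y 1 1 -> X = Y.
Proof.
move=> a b c d; apply/matrixP => i j.
have ord2P (k : 'I_2) : k = 0 \/ k = 1.
  by case: k => [[|[|//]] ?]; [left|right]; apply: val_inj.
by case: (ord2P i) => ->; case: (ord2P j) => ->.
Qed.

Lemma mulmx2E X Y (i j : 'I_2) : (X *m Y) i j = X i 0 * Y 0 j + X i 1 * Y 1 j.
Proof.
rewrite mxE !big_ord_recl big_ord0 addr0; congr (X _ _ * Y _ _ + X _ _ * Y _ _);
  exact: val_inj.
Qed.

Lemma adjE X i j : adj X i j = quat_conj (X j i).
Proof. by rewrite !mxE. Qed.

Lemma adjM X Y : adj (X *m Y) = adj Y *m adj X.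
Proof.
by apply/matrixP => i j; rewrite adjE !mulmx2E !adjE quat_conjD !quat_conjM.
Qed.

Lemma adjK X : adj (adj X) = X.
Proof. by apply/matrixP => i j; rewrite !adjE quat_conjK. Qed.

Lemma adj1 : adj 1%:M = 1%:M :> 'M[quat R]_2.
Proof.
apply/matrixP => i j; rewrite adjE !mxE eq_sym.
by case: (i == j); rewrite /= ?quat_conj1 ?quat_conj0.
Qed.

Lemma Sp2_set1 : Sp2 R (1%:M : 'M[quat R]_2).
Proof. by rewrite /Sp2 /= adj1 !mulmx1. Qed.

Lemma Sp2_setM p q : Sp2 R p -> Sp2 R q -> Sp2 R (p *m q).
Proof.
move=> [pl pr] [ql qr']; rewrite /Sp2 /= adjM; split.
  by rewrite -mulmxA [q *m _]mulmxA ql mul1mx.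
by rewrite -mulmxA [adj p *m _]mulmxA pr mul1mx.
Qed.

Lemma Sp2_setV p : Sp2 R p -> Sp2 R (adj p).
Proof. by move=> [pl pr]; rewrite /Sp2 /= adjK. Qed.

Lemma mx2M (a b c d a' b' c' d' : quat R) :
  mx2 a b c d *m mx2 a' b' c' d' =
  mx2 (a * a' + b * c') (a * b' + b * d') (c * a' + d * c') (c * b' + d * d').
Proof. by apply: mx2P; rewrite mulmx2E !mxE. Qed.

Lemma dg2M (a b c d : quat R) : dg2 a b *m dg2 c d = dg2 (a * c) (b * d).
Proof. by rewrite /dg2 mx2M !(mul0r, mulr0, addr0, add0r). Qed.

Lemma dg2_1 : dg2 1 1 = 1%:M :> 'M[quat R]_2.
Proof. by apply: mx2P; rewrite !mxE. Qed.

Lemma adj_dg2 (a b : quat R) : adj (dg2 a b) = dg2 (quat_conj a) (quat_conj b).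
Proof. by apply: mx2P; rewrite adjE !mxE //= quat_conj0. Qed.

End Algebra.

Definition Sp2_one (R : realType) : Sp2 R := mk_sub (@Sp2_set1 R).
Definition Sp2_mul (R : realType) (p q : Sp2 R) : Sp2 R :=
  mk_sub (Sp2_setM (set_valP p) (set_valP q)).
Definition Sp2_inv (R : realType) (p : Sp2 R) : Sp2 R :=
  mk_sub (Sp2_setV (set_valP p)).

Definition Sp1U1 (R : realType) : set (Sp2 R) :=
  [set h | exists (t : R) (a : quat R),
     a * quat_conj a = 1 /\ \val h = dg2 (quat_expi t) a].
Arguments Sp1U1 : clear implicits.

Definition T2 (R : realType) : set (Sp2 R) :=
  [set t | exists u v : R, \val t = dg2 (quat_expi u) (quat_expi v)].
Arguments T2 : clear implicits.

Definition sp2_alg (R : realType) : set 'M[quat R]_2 := [set X | adj X = - X].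

Definition h_alg (R : realType) : set 'M[quat R]_2 :=
  [set X | exists (t : R) (a : quat R),
     quat_conj a = - a /\ X = dg2 (quat_cpx 0 t) a].

Definition m_space (R : realType) : set 'M[quat R]_2 :=
  [set X | exists (x1 x2 : R) (rho : quat R),
     X = mx2 (quat_cpx x1 x2 * quat_j R) rho (- quat_conj rho) 0].

Definition proj_m (R : realType) (X : 'M[quat R]_2) : 'M[quat R]_2 :=
  mx2 (Quat 0 0 (qj (X 0 0)) (qk (X 0 0))) (X 0 1) (X 1 0) 0.

(* proj_m is the projection of sp(2) onto m along h *)
Lemma proj_mP (R : realType) (X : 'M[quat R]_2) : sp2_alg X ->
  m_space (proj_m X) /\ h_alg (X - proj_m X).
Proof.
move=> aX; have E i j : quat_conj (X j i) = - X i j.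
  by move/matrixP: aX => /(_ i j); rewrite adjE mxE.
split.
  exists (qj (X 0 0)), (qk (X 0 0)), (X 0 1); rewrite E opprK.
  by congr mx2; apply: quat_eqP => /=; ring.
exists (qi (X 0 0)), (X 1 1); split; first exact: E.
apply: mx2P; rewrite !mxE /= ?subrr ?subr0 //.
have /= e0 := congr1 (@qr R) (E 0 0); apply: quat_eqP => /=;
  rewrite ?subr0 ?subrr //.
by apply/eqP; rewrite -[_ == 0](mulrn_eq0 _ 2) mulr2n {1}e0 addNr.
Qed.
Lemma proj_m_id (R : realType) (X : 'M[quat R]_2) : m_space X -> proj_m X = X.
Proof.
move=> [x1 [x2 [rho ->]]]; apply: mx2P; rewrite !mxE //=.
by apply: quat_eqP => /=; ring.
Qed.
Lemma proj_m_h (R : realType) (X : 'M[quat R]_2) : h_alg X -> proj_m X = 0.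
Proof. by move=> [t [a [_ ->]]]; apply: mx2P; rewrite !mxE. Qed.

Definition g0 (R : realType) (X Y : 'M[quat R]_2) : R := qr (\tr (adj X *m Y)).

Definition A0 (R : realType) : 'M[quat R]_2 := dg2 (quat_expi (2 * pi / 3)) 1.
Lemma A0V (R : realType) :
  A0 R *m adj (A0 R) = 1%:M /\ adj (A0 R) *m A0 R = 1%:M.
Proof.
rewrite /A0 adj_dg2 !dg2M quat_conj1 !mulr1 quat_expi_unit.
by rewrite quat_conj_unit ?quat_expi_unit ?dg2_1.
Qed.

(* adj (A0 R) is the inverse of A0 R *)
Definition J0 (R : realType) (X : 'M[quat R]_2) : 'M[quat R]_2 :=
  quat_real (2 / Num.sqrt 3) *:
    (A0 R *m X *m adj (A0 R) + quat_real 2^-1 *: X).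

Definition sigma0 (R : realType) (X Y : 'M[quat R]_2) : R := g0 (J0 X) Y.

Definition Umx (R : realType) : 'M[quat R]_2 := dg2 (quat_cpx 0 1) 0.
Definition Vmx (R : realType) : 'M[quat R]_2 := dg2 0 (quat_cpx 0 1).

Definition nu (R : realType) (p : Sp2 R) : R :=
  sigma0 (proj_m (\val (Sp2_inv p) *m Umx R *m \val p))
         (proj_m (\val (Sp2_inv p) *m Vmx R *m \val p)).

Section CP3.
Context {R : realType}.
Implicit Types (p q r h : Sp2 R).

Lemma Sp2_mulA p q r : Sp2_mul p (Sp2_mul q r) = Sp2_mul (Sp2_mul p q) r.
Proof. by apply: val_inj => /=; rewrite mulmxA. Qed.
Lemma Sp2_mul1 p : Sp2_mul (Sp2_one R) p = p.
Proof. by apply: val_inj => /=; rewrite mul1mx. Qed.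
Lemma Sp2_mulr1 p : Sp2_mul p (Sp2_one R) = p.
Proof. by apply: val_inj => /=; rewrite mulmx1. Qed.
Lemma Sp2_mulV p : Sp2_mul p (Sp2_inv p) = Sp2_one R.
Proof. by apply: val_inj => /=; case: (set_valP p). Qed.
Lemma Sp2_mulVl p : Sp2_mul (Sp2_inv p) p = Sp2_one R.
Proof. by apply: val_inj => /=; case: (set_valP p). Qed.

Lemma Sp1U1_1 : Sp1U1 R (Sp2_one R).
Proof.
by exists 0, 1; rewrite quat_conj1 mulr1 /= quat_expi0 dg2_1.
Qed.
Lemma Sp1U1_M h r : Sp1U1 R h -> Sp1U1 R r -> Sp1U1 R (Sp2_mul h r).
Proof.
move=> [t [a [ea eh]]] [s [b [eb er]]]; exists (t + s), (a * b); split.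
  by rewrite quat_conjM mulrA -[a * b * _]mulrA eb mulr1.
by rewrite /= eh er dg2M quat_expiD.
Qed.
Lemma Sp1U1_V h : Sp1U1 R h -> Sp1U1 R (Sp2_inv h).
Proof.
move=> [t [a [ea eh]]]; exists (- t), (quat_conj a).
by rewrite quat_conjK quat_conj_unit //= eh adj_dg2 quat_expiN.
Qed.

Lemma T2_1 : T2 R (Sp2_one R).
Proof. by exists 0, 0; rewrite /= quat_expi0 dg2_1. Qed.
Lemma T2_M h r : T2 R h -> T2 R r -> T2 R (Sp2_mul h r).
Proof.
move=> [u [v eh]] [u' [v' er]]; exists (u + u'), (v + v').
by rewrite /= eh er dg2M !quat_expiD.
Qed.
Lemma T2_V h : T2 R h -> T2 R (Sp2_inv h).
Proof.
move=> [u [v eh]]; exists (- u), (- v).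
by rewrite /= eh adj_dg2 !quat_expiN.
Qed.

Definition CP3_rel p q : bool := `[< exists2 h, Sp1U1 R h & q = Sp2_mul p h >].

Lemma CP3_rel_refl : reflexive CP3_rel.
Proof.
move=> p; apply/asboolP.
by exists (Sp2_one R); [exact: Sp1U1_1|rewrite Sp2_mulr1].
Qed.
Lemma CP3_rel_imp p q : CP3_rel p q -> CP3_rel q p.
Proof.
move=> /asboolP[h hH ->]; apply/asboolP.
exists (Sp2_inv h); first exact: Sp1U1_V.
by rewrite -Sp2_mulA Sp2_mulV Sp2_mulr1.
Qed.
Lemma CP3_rel_sym : symmetric CP3_rel.
Proof. by move=> p q; apply/idP/idP; exact: CP3_rel_imp. Qed.
Lemma CP3_rel_trans : transitive CP3_rel.
Proof.
move=> q p r /asboolP[h hH ->] /asboolP[k kH ->]; apply/asboolP.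
by exists (Sp2_mul h k); [exact: Sp1U1_M|rewrite Sp2_mulA].
Qed.
Definition CP3_equiv : equiv_rel (Sp2 R) :=
  EquivRel CP3_rel CP3_rel_refl CP3_rel_sym CP3_rel_trans.
End CP3.

(* the space of cosets p Sp(1)U(1) *)
Definition CP3 (R : realType) : Type :=
  quotient_topology {eq_quot (@CP3_equiv R)}.
HB.instance Definition _ (R : realType) := Topological.on (CP3 R).
HB.instance Definition _ (R : realType) := Quotient.on (CP3 R).

Lemma topq_eqP (T : topologicalType) (e : equiv_rel T) (x y : T) :
  reflect (\pi_(quotient_topology {eq_quot e}) x =
           \pi_(quotient_topology {eq_quot e}) y) (e x y).
Proof. exact: (@eqmodP T e x y). Qed.

Lemma CP3P (R : realType) (p q : Sp2 R) :
  reflect (\pi_(CP3 R) p = \pi_(CP3 R) q) (CP3_rel p q).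
Proof. exact: topq_eqP. Qed.

Section Nu.
Context {R : realType}.
Implicit Types (p q h t : Sp2 R) (X Y : 'M[quat R]_2).

Lemma quat_realC (c : R) (x : quat R) : quat_real c * x = x * quat_real c.
Proof. by apply: quat_eqP => /=; ring. Qed.

Lemma scale_real_mulr (c : R) X Y :
  quat_real c *: (X *m Y) = X *m (quat_real c *: Y).
Proof.
apply/matrixP => i j; rewrite mxE !mulmx2E !mxE mulrDr.
by rewrite !mulrA !quat_realC.
Qed.

Lemma quat_expi_cpxC (s t : R) :
  quat_expi s * quat_expi t = quat_expi t * quat_expi s.
Proof. by rewrite -!quat_expiD addrC. Qed.

Lemma proj_m_Ad h X : Sp1U1 R h ->
  proj_m (adj (\val h) *m X *m \val h) = adj (\val h) *m proj_m X *m \val h.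
Proof.
move=> [t [a [_ ->]]]; rewrite adj_dg2.
by apply: mx2P; rewrite !(mulmx2E, mxE) //=;
   rewrite ?(mulr0, mul0r, addr0, add0r) //; apply: quat_eqP => /=; ring.
Qed.

Lemma J0_Ad h X : Sp1U1 R h ->
  J0 (adj (\val h) *m X *m \val h) = adj (\val h) *m J0 X *m \val h.
Proof.
move=> [t [a [_ ->]]]; rewrite /J0 -[in RHS]scale_real_mulr -scalemxAl.
congr (_ *: _); rewrite mulmxDr mulmxDl; congr (_ + _); last first.
  by rewrite -[in RHS]scale_real_mulr -scalemxAl.
have cA : A0 R *m adj (dg2 (quat_expi t) a) = adj (dg2 (quat_expi t) a) *m A0 R.
  by rewrite /A0 adj_dg2 !dg2M -quat_expiN quat_expi_cpxC mul1r mulr1.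
have cB : adj (A0 R) *m dg2 (quat_expi t) a = dg2 (quat_expi t) a *m adj (A0 R).
  by rewrite -[LHS]adjK adjM adjK -cA adjM adjK.
by rewrite !mulmxA cA -!mulmxA -cB.
Qed.

Lemma qr_trC X Y : qr (\tr (X *m Y)) = qr (\tr (Y *m X)).
Proof.
have trE (Z : 'M[quat R]_2) : \tr Z = Z 0 0 + Z 1 1.
  rewrite /mxtrace !big_ord_recl big_ord0 addr0; congr (Z _ _ + Z _ _);
  exact: val_inj.
by rewrite !trE !mulmx2E /=; ring.
Qed.

Lemma g0_Ad h X Y :
  g0 (adj (\val h) *m X *m \val h) (adj (\val h) *m Y *m \val h) = g0 X Y.
Proof.
have [hl hr] := set_valP h.
rewrite /g0 !adjM adjK !mulmxA qr_trC !mulmxA hl mul1mx.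
by rewrite -[adj X *m _ *m _]mulmxA hl mulmx1.
Qed.

Lemma nu_Sp1U1 p h : Sp1U1 R h -> nu (Sp2_mul p h) = nu p.
Proof.
move=> hH; rewrite /nu.
have E Z : \val (Sp2_inv (Sp2_mul p h)) *m Z *m \val (Sp2_mul p h) =
    adj (\val h) *m (\val (Sp2_inv p) *m Z *m \val p) *m \val h.
  by rewrite /= adjM !mulmxA.
have E2 Z := congr1 (@proj_m R) (E Z).
rewrite (E2 (Umx R)) (E2 (Vmx R)).
move: (\val (Sp2_inv p) *m Umx R *m \val p) => X.
move: (\val (Sp2_inv p) *m Vmx R *m \val p) => Y.
rewrite (proj_m_Ad X hH) (proj_m_Ad Y hH) /sigma0 (J0_Ad (proj_m X) hH).
exact: g0_Ad.
Qed.
End Nu.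

(* well defined on cosets: nu_CP3E *)
Definition nu_CP3 (R : realType) (x : CP3 R) : R := nu (repr x).

Lemma nu_CP3E (R : realType) (p : Sp2 R) : nu_CP3 (\pi_(CP3 R) p) = nu p.
Proof.
have /asboolP[h hH e] : CP3_rel (repr (\pi_(CP3 R) p)) p.
  by apply/CP3P; rewrite reprK.
by rewrite [in RHS]e nu_Sp1U1.
Qed.

Definition T2_act (R : realType) (t : T2 R) (x : CP3 R) : CP3 R :=
  \pi_(CP3 R) (Sp2_mul (\val t) (repr x)).

Lemma T2_actE (R : realType) (t : T2 R) (p : Sp2 R) :
  T2_act t (\pi_(CP3 R) p) = \pi_(CP3 R) (Sp2_mul (\val t) p).
Proof.
rewrite /T2_act; apply/CP3P; apply/asboolP.
have /asboolP[h hH e] : CP3_rel (repr (\pi_(CP3 R) p)) p.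
  by apply/CP3P; rewrite reprK.
by exists h => //; rewrite -Sp2_mulA -e.
Qed.

Lemma T2_act1 (R : realType) (x : CP3 R) : T2_act (mk_sub (@T2_1 R)) x = x.
Proof. rewrite -[x]reprK T2_actE; congr (\pi_(CP3 R) _); exact: Sp2_mul1. Qed.
Lemma T2_actM (R : realType) (s t : T2 R) (x : CP3 R) :
  T2_act (mk_sub (T2_M (set_valP s) (set_valP t))) x = T2_act s (T2_act t x).
Proof.
rewrite -[x]reprK !T2_actE; congr (\pi_(CP3 R) _).
by rewrite reprK; exact: esym (Sp2_mulA _ _ _).
Qed.

Definition nu_zero (R : realType) : set (CP3 R) := [set x | nu_CP3 x = 0].
Arguments nu_zero : clear implicits.

Section NuOrbits.
Context {R : realType}.
Implicit Types x y : nu_zero R.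

Definition nu_orbit_rel x y : bool :=
  `[< exists t : T2 R, \val y = T2_act t (\val x) >].

Lemma nu_orbit_refl : reflexive nu_orbit_rel.
Proof. by move=> x; apply/asboolP; exists (mk_sub T2_1); rewrite T2_act1. Qed.
Lemma nu_orbit_imp x y : nu_orbit_rel x y -> nu_orbit_rel y x.
Proof.
move=> /asboolP[t e]; apply/asboolP; exists (mk_sub (T2_V (set_valP t))).
rewrite e -T2_actM -[LHS]T2_act1; congr T2_act; apply: val_inj.
exact: esym (Sp2_mulVl _).
Qed.
Lemma nu_orbit_sym : symmetric nu_orbit_rel.
Proof. by move=> x y; apply/idP/idP; exact: nu_orbit_imp. Qed.
Lemma nu_orbit_trans : transitive nu_orbit_rel.
Proof.
move=> y x z /asboolP[t e] /asboolP[s e']; apply/asboolP.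
by exists (mk_sub (T2_M (set_valP s) (set_valP t))); rewrite T2_actM -e.
Qed.
Definition nu_orbit_equiv : equiv_rel (nu_zero R) :=
  EquivRel nu_orbit_rel nu_orbit_refl nu_orbit_sym nu_orbit_trans.
End NuOrbits.

Definition nu_zero_mod_T2 (R : realType) : Type :=
  quotient_topology {eq_quot (@nu_orbit_equiv R)}.
HB.instance Definition _ (R : realType) := Topological.on (nu_zero_mod_T2 R).
HB.instance Definition _ (R : realType) := Quotient.on (nu_zero_mod_T2 R).

Definition nonzero4 (R : realType) : set 'rV[R]_4 := [set x | x != 0].
Arguments nonzero4 : clear implicits.

Section RP3.
Context {R : realType}.
Implicit Types x y : nonzero4 R.

Definition RP3_rel x y : bool :=
  `[< exists2 c : R, c != 0 & \val y = c *: \val x >].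

Lemma RP3_rel_refl : reflexive RP3_rel.
Proof. by move=> x; apply/asboolP; exists 1; rewrite ?oner_neq0 ?scale1r. Qed.
Lemma RP3_rel_imp x y : RP3_rel x y -> RP3_rel y x.
Proof.
move=> /asboolP[c c0 e]; apply/asboolP; exists c^-1; rewrite ?invr_eq0 //.
by rewrite e scalerA mulVf ?scale1r.
Qed.
Lemma RP3_rel_sym : symmetric RP3_rel.
Proof. by move=> x y; apply/idP/idP; exact: RP3_rel_imp. Qed.
Lemma RP3_rel_trans : transitive RP3_rel.
Proof.
move=> y x z /asboolP[c c0 e] /asboolP[d d0 e']; apply/asboolP.
by exists (d * c); rewrite ?mulf_neq0 // e' e scalerA.
Qed.
Definition RP3_equiv : equiv_rel (nonzero4 R) :=
  EquivRel RP3_rel RP3_rel_refl RP3_rel_sym RP3_rel_trans.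
End RP3.

Definition RP3 (R : realType) : Type :=
  quotient_topology {eq_quot (@RP3_equiv R)}.
HB.instance Definition _ (R : realType) := Topological.on (RP3 R).
HB.instance Definition _ (R : realType) := Quotient.on (RP3 R).

Lemma RP3P (R : realType) (x y : nonzero4 R) :
  reflect (\pi_(RP3 R) x = \pi_(RP3 R) y) (RP3_rel x y).
Proof. exact: topq_eqP. Qed.

(* The group Z_2^2 is bool * bool under componentwise addb; (true, false) and
   (false, true) act by [z1 : -z2 : z3 : -z4] and [z1 : z2 : -z3 : -z4]. *)
Definition Z22_sign (s : bool * bool) (i : 'I_4) : bool :=
  nth false [:: false; s.1; s.2; s.1 (+) s.2] i.
Definition Z22_add (s t : bool * bool) : bool * bool :=
  (s.1 (+) t.1, s.2 (+) t.2).

Section Z22.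
Context {R : realType}.

Definition Z22_mulrow (s : bool * bool) (x : 'rV[R]_4) : 'rV[R]_4 :=
  \row_i ((-1) ^+ Z22_sign s i * x 0 i).

Lemma Z22_signD s t i :
  Z22_sign (Z22_add s t) i = Z22_sign s i (+) Z22_sign t i.
Proof.
by case: s t i => [[] []] [[] []] [[|[|[|[|]]]] ?].
Qed.

Lemma Z22_mulrowM s t x :
  Z22_mulrow (Z22_add s t) x = Z22_mulrow s (Z22_mulrow t x).
Proof. by apply/rowP => i; rewrite !mxE Z22_signD signr_addb mulrA. Qed.
Lemma Z22_mulrow1 x : Z22_mulrow (false, false) x = x.
Proof.
apply/rowP => i; rewrite !mxE (_ : Z22_sign _ i = false) ?mul1r //.
by case: i => [[|[|[|[|]]]] ?].
Qed.
Lemma Z22_mulrowK s : involutive (Z22_mulrow s).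
Proof.
by move=> x; rewrite -Z22_mulrowM /Z22_add !addbb Z22_mulrow1.
Qed.
Lemma Z22_mulrowZ s (c : R) x : Z22_mulrow s (c *: x) = c *: Z22_mulrow s x.
Proof. by apply/rowP => i; rewrite !mxE mulrCA. Qed.
Lemma Z22_mulrow_neq0 s (x : 'rV[R]_4) :
  nonzero4 R x -> nonzero4 R (Z22_mulrow s x).
Proof.
rewrite /nonzero4 /=; apply: contra_neq => e.
by rewrite -[x](Z22_mulrowK s) e; apply/rowP => i; rewrite !mxE mulr0.
Qed.
End Z22.

Definition Z22_act (R : realType) (s : bool * bool) (x : RP3 R) : RP3 R :=
  \pi_(RP3 R) (mk_sub (Z22_mulrow_neq0 s (set_valP (repr x)))).

Lemma Z22_actE (R : realType) (s : bool * bool) (x : nonzero4 R) :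
  Z22_act s (\pi_(RP3 R) x) =
  \pi_(RP3 R) (mk_sub (Z22_mulrow_neq0 s (set_valP x))).
Proof.
rewrite /Z22_act; apply/RP3P; apply/asboolP.
have /asboolP[c c0 e] : RP3_rel (repr (\pi_(RP3 R) x)) x.
  by apply/RP3P; rewrite reprK.
by exists c => //=; rewrite e Z22_mulrowZ.
Qed.

Section RP3Orbits.
Context {R : realType}.
Implicit Types x y : RP3 R.

Lemma Z22_act1 x : Z22_act (false, false) x = x.
Proof.
rewrite -[x]reprK Z22_actE; congr (\pi_(RP3 R) _); apply: val_inj => /=.
exact: Z22_mulrow1.
Qed.
Lemma Z22_actM s t x : Z22_act (Z22_add s t) x = Z22_act s (Z22_act t x).
Proof.
rewrite -[x]reprK !Z22_actE; congr (\pi_(RP3 R) _); apply: val_inj => /=.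
rewrite reprK; exact: Z22_mulrowM.
Qed.

Definition RP3_orbit_rel x y : bool := `[< exists s, y = Z22_act s x >].

Lemma RP3_orbit_refl : reflexive RP3_orbit_rel.
Proof. by move=> x; apply/asboolP; exists (false, false); rewrite Z22_act1. Qed.
Lemma RP3_orbit_imp x y : RP3_orbit_rel x y -> RP3_orbit_rel y x.
Proof.
move=> /asboolP[s ->]; apply/asboolP; exists s.
by rewrite -Z22_actM /Z22_add !addbb Z22_act1.
Qed.
Lemma RP3_orbit_sym : symmetric RP3_orbit_rel.
Proof. by move=> x y; apply/idP/idP; exact: RP3_orbit_imp. Qed.
Lemma RP3_orbit_trans : transitive RP3_orbit_rel.
Proof.
move=> y x z /asboolP[s ->] /asboolP[t ->]; apply/asboolP.
by exists (Z22_add t s); rewrite Z22_actM.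
Qed.
Definition RP3_orbit_equiv : equiv_rel (RP3 R) :=
  EquivRel RP3_orbit_rel RP3_orbit_refl RP3_orbit_sym RP3_orbit_trans.
End RP3Orbits.

Definition RP3_mod_Z22 (R : realType) : Type :=
  quotient_topology {eq_quot (@RP3_orbit_equiv R)}.
HB.instance Definition _ (R : realType) := Topological.on (RP3_mod_Z22 R).
HB.instance Definition _ (R : realType) := Quotient.on (RP3_mod_Z22 R).

(* Main.v *)
Require Import Defs.
From mathcomp Require Import all_boot all_order all_algebra.
From mathcomp Require Import ring lra.
From mathcomp Require Import all_classical all_reals all_analysis.

(* Write p00 = z1 + w1 j and p10 = z2 + w2 j for the first column of p in Sp(2);
   it determines the coset of p up to the circle acting on the right. The five
   numbers |z1|^2, |w1|^2, |z2|^2, |w2|^2 and Re(conj(z1) w1 z2 conj(w2)) are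
   invariant under T^2 on the left and Sp(1)U(1) on the right, and on
   nu = 12 Im(conj(z1) w1 z2 conj(w2)) = 0 they separate the orbits: the phases
   taking one column to the other can be chosen compatibly, since either the
   common value of the last invariant is nonzero and forces this, or one of the
   coordinates vanishes and its phase is free. Hence nu^-1(0)/T^2 injects
   continuously in R^5 and is Hausdorff. A real unit vector x gives the frame
   with first column (x1 + x3 j, x2 + x4 j), whose invariants are the x_i^2 and
   x1 x2 x3 x4; they determine x up to an even number of sign changes and a
   global sign, and every point of nu^-1(0) has the invariants of some real x.
   The resulting continuous bijection from the compact space RP^3/Z_2^2 onto a
   Hausdorff space is a homeomorphism. *)

Set Implicit Arguments.
Unset Strict Implicit.
Unset Printing Implicit Defensive.
Import Order.TTheory GRing.Theory Num.Theory.
Import numFieldNormedType.Exports.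
Local Open Scope classical_set_scope.
Local Open Scope ring_scope.
Local Open Scope quotient_scope.

(** * Angles: the cube root of unity and plane rotations *)

Section Trigonometry.
Context {R : realType}.

(** With c the cosine of the angle, tripling the angle gives 4c^3 - 3c = 1, that is (c - 1)(2c +
    1)^2 = 0; c = 1 is excluded because the angle lies strictly between 0 and pi. *)
Lemma cos_2pi3 : cos (2 * pi / 3) = - 2^-1 :> R.
Proof.
set t := 2 * pi / 3; have pi0 := pi_gt0 R.
have t0 : 0 < t by rewrite /t; lra.
have c1 : cos t < 1.
  rewrite -cos0 ltr_cos ?in_itv /= ?lexx ?pi_ge0 //.
  by apply/andP; split; rewrite /t; lra.
have : cos (t + (t + t)) = 1 by rewrite -[RHS]cos2pi; congr cos; rewrite /t; field.
rewrite !(cosD, sinD) => c3.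
have := cos2Dsin2 t; move: (cos t) (sin t) c1 c3 => c s c1 c3 cs.
have : (c - 1) * (2 * c + 1) ^+ 2 = 0.
  rewrite [LHS](_ : _ = c * (c * c - s * s) - s * (s * c + c * s) - 1
    + 3 * c * (c ^+ 2 + s ^+ 2 - 1)); last by ring.
  by rewrite c3 cs !subrr mulr0 addr0.
move/eqP; rewrite mulf_eq0 sqrf_eq0 => /orP[] /eqP e; lra.
Qed.

Lemma sin_2pi3 : sin (2 * pi / 3) = Num.sqrt 3 / 2 :> R.
Proof.
have pi0 := pi_gt0 R; set t := 2 * pi / 3.
have s0 : 0 < sin t by apply: sin_gt0_pi; apply/andP; split; rewrite /t; lra.
apply/eqP; rewrite -(@eqrXn2 _ 2) ?(ltW s0) ?divr_ge0 ?sqrtr_ge0 //.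
rewrite sin2cos2 cos_2pi3 expr_div_n sqr_sqrtr ?ler0n //.
by apply/eqP; field.
Qed.

Lemma circle_angle (c s : R) : c ^+ 2 + s ^+ 2 = 1 ->
  exists t, c = cos t /\ s = sin t.
Proof.
move=> cs; have c1 : -1 <= c <= 1.
  have := sqr_ge0 s; have := sqr_ge0 (c - 1); have := sqr_ge0 (c + 1); nra.
have sE : sin (acos c) = `|s|.
  by rewrite sin_acos // -cs addrAC subrr add0r sqrtr_sqr.
case: (leP 0 s) => s0.
  by exists (acos c); rewrite acosK ?in_itv // sE ger0_norm.
exists (- acos c); rewrite cosN sinN acosK ?in_itv // sE ltr0_norm //.
by rewrite opprK.
Qed.

Lemma sqrD_eq0 (x y : R) : x ^+ 2 + y ^+ 2 = 0 -> x = 0 /\ y = 0.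
Proof.
move=> /eqP; rewrite paddr_eq0 ?sqr_ge0 // !sqrf_eq0.
by move=> /andP[/eqP -> /eqP].
Qed.

Lemma rotation_angle (x y u v : R) : x ^+ 2 + y ^+ 2 = u ^+ 2 + v ^+ 2 ->
  exists t, u = cos t * x - sin t * y /\ v = sin t * x + cos t * y.
Proof.
move=> e; have [n0|n0] := eqVneq (x ^+ 2 + y ^+ 2) 0.
  have [-> ->] := sqrD_eq0 n0.
  have [-> ->] := sqrD_eq0 (etrans (esym e) n0).
  by exists 0; rewrite !mulr0 subrr addr0.
set n := x ^+ 2 + y ^+ 2 in n0.
(* These are the real and imaginary parts of (u + iv)/(x + iy), a complex number of modulus 1. *)
have [|t [ct st]] := @circle_angle ((x * u + y * v) / n) ((x * v - y * u) / n).
  rewrite !expr_div_n -mulrDl.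
  have -> : (x * u + y * v) ^+ 2 + (x * v - y * u) ^+ 2 = n * (u ^+ 2 + v ^+ 2).
    by rewrite /n; ring.
  by rewrite -e -/n -expr2 divff // expf_eq0.
by exists t; rewrite -ct -st; split; move: n0; rewrite /n => n0; field.
Qed.
End Trigonometry.

(** * The multi-moment map in terms of the first column *)

Section MomentMap.
Context {R : realType}.
Implicit Types (x y a b c d : quat R) (p q : Sp2 R).

Definition quat_dot x y : R := qr (quat_conj x * y).

(** For the cube root of unity w in [A0], w + 1/2 = i sqrt(3)/2 and w^2 + 1/2 = -i sqrt(3)/2. So
    [J0] multiplies the upper left entry by -i on the left, [r] by i on the left and [s] by -i on
    the right. *)
Lemma J0E (x1 x2 : R) (r s : quat R) :
  J0 (mx2 (Quat 0 0 x1 x2) r s 0) =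
  mx2 (Quat 0 0 x2 (- x1)) (quat_cpx 0 1 * r) (- (s * quat_cpx 0 1)) 0.
Proof.
have s3 : Num.sqrt 3 != 0 :> R by rewrite sqrtr_eq0 -ltNge ltr0n.
have s2 : Num.sqrt 3 ^+ 2 = 3 :> R by rewrite sqr_sqrtr ?ler0n.
apply: mx2P; rewrite !(mulmx2E, mxE) /=; apply: quat_eqP => /=;
  rewrite ?mxE /= ?(cos_2pi3, sin_2pi3); field: s2; rewrite ?s3 //.
Qed.

Lemma sigma0E (x1 x2 y1 y2 : R) (r s r' s' : quat R) :
  sigma0 (mx2 (Quat 0 0 x1 x2) r s 0) (mx2 (Quat 0 0 y1 y2) r' s' 0) =
  x2 * y1 - x1 * y2 + quat_dot (quat_cpx 0 1 * r) r'
  - quat_dot (s * quat_cpx 0 1) s'.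
Proof.
rewrite /sigma0 J0E /g0 /mxtrace !big_ord_recl big_ord0 /=.
rewrite !(mulmx2E, mxE) /= /quat_dot /=; ring.
Qed.

(* The real and imaginary parts of conj(z) w, where a = z + w j. *)
Definition tw_re a : R := qr a * qj a + qi a * qk a.
Definition tw_im a : R := qr a * qk a - qi a * qj a.

(** For a first column (z1 + w1 j, z2 + w2 j) the bracket is Im(conj(z1) w1 z2 conj(w2)). *)
Lemma nuE p : nu p =
  12 * (tw_im (\val p 0 0) * tw_re (\val p 1 0)
        - tw_re (\val p 0 0) * tw_im (\val p 1 0)).
Proof.
have [/matrixP orth _] := set_valP p.
have := orth 0 1; rewrite mulmx2E !adjE [RHS]mxE /= => /addr0_eq; move: orth => _.
rewrite /nu /= /proj_m sigma0E !(mulmx2E, mxE) /=.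
move: (\val p 0 0) (\val p 0 1) (\val p 1 0) (\val p 1 1) => a c b d orth.
rewrite !(mulr0, mul0r, addr0, add0r).
set I := quat_cpx 0 1 : quat R.
(* Cyclicity of the real part brings c and d together as c * conj d, which is
   - a * conj b since the rows of p are orthogonal. *)
have -> : quat_dot (I * (quat_conj a * I * c)) (quat_conj b * I * d) =
    qr (I * a * I * quat_conj b * I * quat_conj (c * quat_conj d)).
  by rewrite /quat_dot /=; ring.
have -> : quat_dot (quat_conj c * I * a * I) (quat_conj d * I * b) =
    qr (I * quat_conj a * I * (c * quat_conj d) * I * b).
  by rewrite /quat_dot /=; ring.
by rewrite -orth /tw_re /tw_im /=; ring.
Qed.
End MomentMap.

(** * Five invariants that separate the torus orbits on the zero level *)

Section Invariants.
Context {R : realType}.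
Implicit Types (a b : quat R) (p q : Sp2 R).

(* The squares of |z| and |w|, where a = z + w j. *)
Definition z_norm a : R := qr a ^+ 2 + qi a ^+ 2.
Definition w_norm a : R := qj a ^+ 2 + qk a ^+ 2.

Definition col_inv a b : R * R * R * R * R :=
  (z_norm a, w_norm a, z_norm b, w_norm b,
   tw_re a * tw_re b + tw_im a * tw_im b).

Definition Sp2_inv5 p := col_inv (\val p 0 0) (\val p 1 0).

Definition rotated (t x y u v : R) : Prop :=
  u = cos t * x - sin t * y /\ v = sin t * x + cos t * y.

Definition cpx_rotated (s t : R) a a' : Prop :=
  rotated s (qr a) (qi a) (qr a') (qi a') /\
  rotated t (qj a) (qk a) (qj a') (qk a').

(** Since j e^(iv) = e^(-iv) j, the product e^(iu) (z + w j) e^(iv) equals e^(i(u+v)) z + e^(i(u-v))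
    w j. *)
Lemma expi_mul_rotated (u v : R) a a' :
  cpx_rotated (u + v) (u - v) a a' <-> a' = quat_expi u * a * quat_expi v.
Proof.
split.
  case: a' => r i j k [[/= -> ->] [-> ->]].
  by apply: quat_eqP => /=; rewrite ?(cosD, sinD, cosN, sinN); ring.
by move=> ->; do 2![split => /=]; rewrite ?(cosD, sinD, cosN, sinN); ring.
Qed.

Lemma tw_rotated (s t : R) a a' : cpx_rotated s t a a' ->
  tw_re a' = cos (t - s) * tw_re a - sin (t - s) * tw_im a /\
  tw_im a' = sin (t - s) * tw_re a + cos (t - s) * tw_im a.
Proof.
by move=> [[e1 e2] [e3 e4]]; rewrite /tw_re /tw_im e1 e2 e3 e4 cosB sinB;
  split; ring.
Qed.

Lemma rotated_norm (t x y u v : R) :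
  rotated t x y u v -> u ^+ 2 + v ^+ 2 = x ^+ 2 + y ^+ 2.
Proof.
move=> [-> ->]; rewrite -[RHS]mul1r -(cos2Dsin2 t); ring.
Qed.

(** Both conj(z1) w1 and conj(z2) w2 are multiplied by the same unit complex number, which cancels
    in the product of the first with the conjugate of the second. *)
Lemma col_inv_rotated (s t s' t' : R) a b a' b' : t - s = t' - s' ->
  cpx_rotated s t a a' -> cpx_rotated s' t' b b' ->
  col_inv a' b' = col_inv a b.
Proof.
move=> e ra rb; have [ea ea'] := tw_rotated ra; have [eb eb'] := tw_rotated rb.
rewrite /col_inv /z_norm /w_norm (rotated_norm ra.1) (rotated_norm ra.2).
rewrite (rotated_norm rb.1) (rotated_norm rb.2); congr (_, _).
rewrite ea ea' eb eb' e -[RHS]mul1r -(cos2Dsin2 (t' - s')); ring.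
Qed.

Lemma rotated0 (t x y u v : R) : x ^+ 2 + y ^+ 2 = 0 ->
  x ^+ 2 + y ^+ 2 = u ^+ 2 + v ^+ 2 -> rotated t x y u v.
Proof.
move=> n0 e; have [-> ->] := sqrD_eq0 n0.
have [-> ->] := sqrD_eq0 (etrans (esym e) n0).
by split; rewrite !mulr0 ?subrr ?addr0.
Qed.

Lemma balanced_angles a b a' b' :
  tw_im a * tw_re b - tw_re a * tw_im b = 0 ->
  tw_im a' * tw_re b' - tw_re a' * tw_im b' = 0 ->
  col_inv a b = col_inv a' b' ->
  exists s t s' t', [/\ s - t = s' - t', cpx_rotated s t a a' &
    cpx_rotated s' t' b b'].
Proof.
move=> i0 i0' [e1 e2 e3 e4 e5].
have [s hs] := rotation_angle e1; have [t ht] := rotation_angle e2.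
have [s' hs'] := rotation_angle e3; have [t' ht'] := rotation_angle e4.
(* A vanishing coordinate is carried to its (vanishing) counterpart by every angle, so its angle can
   be chosen to balance the differences. *)
have [n1|n1] := eqVneq (z_norm a) 0.
  exists (s' - t' + t), t, s', t'; split => //; first by ring.
  by split => //; exact: rotated0.
have [n2|n2] := eqVneq (w_norm a) 0.
  exists s, (s - s' + t'), s', t'; split => //; first by ring.
  by split => //; exact: rotated0.
have [n3|n3] := eqVneq (z_norm b) 0.
  exists s, t, (s - t + t'), t'; split => //; first by ring.
  by split => //; exact: rotated0.
have [n4|n4] := eqVneq (w_norm b) 0.
  exists s, t, s', (s' - s + t); split => //; first by ring.
  by split => //; exact: rotated0.
set r := tw_re a * tw_re b + tw_im a * tw_im b in e5.
(* The modulus of the complex number with real part [r] is the product of the four nonzero moduli,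
   and its imaginary part is zero. *)
have r0 : r != 0.
  rewrite -sqrf_eq0; have -> : r ^+ 2 = z_norm a * w_norm a * (z_norm b * w_norm b)
      - (tw_im a * tw_re b - tw_re a * tw_im b) ^+ 2.
    by rewrite /r /z_norm /w_norm /tw_re /tw_im; ring.
  by rewrite i0 expr0n subr0 !mulf_neq0.
have ra : cpx_rotated s t a a' by [].
have rb : cpx_rotated s' t' b b' by [].
have [ea ea'] := tw_rotated ra; have [eb eb'] := tw_rotated rb.
(* The product conj(z1) w1 z2 conj(w2) is multiplied by e^(id) from one column to the other; as it
   is real, nonzero and unchanged, e^(id) = 1. *)
set d := (t - s) - (t' - s').
have re' : tw_re a' * tw_re b' + tw_im a' * tw_im b' =
    cos d * r - sin d * (tw_im a * tw_re b - tw_re a * tw_im b).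
  by rewrite ea ea' eb eb' /d /r [cos (_ - (_ - _))]cosB [sin (_ - (_ - _))]sinB; ring.
have im' : tw_im a' * tw_re b' - tw_re a' * tw_im b' =
    sin d * r + cos d * (tw_im a * tw_re b - tw_re a * tw_im b).
  by rewrite ea ea' eb eb' /d /r [cos (_ - (_ - _))]cosB [sin (_ - (_ - _))]sinB; ring.
have c1 : cos d = 1.
  by apply: (mulIf r0); rewrite mul1r [RHS]e5 re' i0 mulr0 subr0.
have s0 : sin d = 0.
  by apply: (mulIf r0); rewrite mul0r -[RHS]i0' im' i0 mulr0 addr0.
(* [d] is only known to be a multiple of 2 pi; adding it to [t'] keeps the rotation and makes the
   differences equal. *)
exists s, t, s', (t' + d); split => //; first by rewrite /d; ring.
split => //; rewrite /rotated cosD sinD c1 s0 !mulr0 !mulr1 subr0 addr0.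
by case: rb.
Qed.

Lemma Sp2_expi (u v : R) : Sp2 R (dg2 (quat_expi u) (quat_expi v)).
Proof.
rewrite /Sp2 /= adj_dg2 !dg2M !quat_conj_unit ?quat_expi_unit //.
by rewrite dg2_1.
Qed.

(** The matrix p^(-1) q has first column (1, 0); unitarity makes its first row (1, 0) too, leaving
    diag(1, alpha) with alpha a unit quaternion. *)
Lemma CP3_rel_col p q : \val p 0 0 = \val q 0 0 -> \val p 1 0 = \val q 1 0 ->
  CP3_rel p q.
Proof.
move=> e0 e1; set h := Sp2_mul (Sp2_inv p) q.
have h00 : \val h 0 0 = 1.
  rewrite /= mulmx2E !adjE -e0 -e1 -!adjE -mulmx2E.
  by case: (set_valP p) => _ ->; rewrite mxE.
have h10 : \val h 1 0 = 0.
  rewrite /= mulmx2E !adjE -e0 -e1 -!adjE -mulmx2E.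
  by case: (set_valP p) => _ ->; rewrite mxE.
have hE : q = Sp2_mul p h by rewrite Sp2_mulA Sp2_mulV Sp2_mul1.
move: (h) h00 h10 hE => {h} h h00 h10 ->.
have [hl hr] := set_valP h.
have h01 : \val h 0 1 = 0.
  move/matrixP: hr => /(_ 0 1); rewrite mulmx2E !adjE h00 h10 [RHS]mxE /=.
  by rewrite quat_conj1 quat_conj0 mul1r mul0r addr0 => ->.
apply/asboolP; exists h => //.
exists 0, (\val h 1 1); split.
  move/matrixP: hl => /(_ 1 1); rewrite mulmx2E !adjE h10 [RHS]mxE /=.
  by rewrite mul0r add0r.
by rewrite quat_expi0; apply: mx2P; rewrite ?h00 ?h01 ?h10 !mxE.
Qed.

(** The upper entry gets phases u + s and u - s, the lower one v + s and v - s: both pairs differ by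
    2s. *)
Lemma torus_act_inv5 (t h : Sp2 R) p : T2 R t -> Sp1U1 R h ->
  Sp2_inv5 (Sp2_mul t (Sp2_mul p h)) = Sp2_inv5 p.
Proof.
move=> [u [v et]] [s [c [_ eh]]].
apply: (@col_inv_rotated (u + s) (u - s) (v + s) (v - s)); first by ring.
  apply/expi_mul_rotated; rewrite /= mulmx2E et eh !mulmx2E !mxE /=.
  by rewrite !(mulr0, mul0r, addr0) mulrA.
apply/expi_mul_rotated; rewrite /= mulmx2E et eh !mulmx2E !mxE /=.
by rewrite !(mulr0, mul0r, addr0, add0r) mulrA.
Qed.

Lemma inv5_torus_orbit p q : nu p = 0 -> nu q = 0 -> Sp2_inv5 p = Sp2_inv5 q ->
  exists t : T2 R, CP3_rel (Sp2_mul (\val t) p) q.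
Proof.
have n12 : 12 != 0 :> R by rewrite pnatr_eq0.
rewrite !nuE => /eqP; rewrite mulf_eq0 (negPf n12) /= => /eqP p0.
move=> /eqP; rewrite mulf_eq0 (negPf n12) /= => /eqP q0 e.
have [s [t [s' [t' [d r r']]]]] := balanced_angles p0 q0 e.
(* [u] and [u'] are the left torus angles and [v] the right circle angle. One [v] serves both
   entries because s - t = s' - t'. *)
pose u := (s + t) / 2; pose v := (s - t) / 2; pose u' := (s' + t') / 2.
have T2u : T2 R (mk_sub (Sp2_expi u u')) by exists u, u'.
have Sp2v : Sp2 R (dg2 (quat_expi v) 1) by rewrite -quat_expi0; exact: Sp2_expi.
exists (mk_sub T2u) => /=.
apply: (@CP3_rel_trans _ (Sp2_mul (mk_sub (Sp2_expi u u')) (Sp2_mul p (mk_sub Sp2v)))).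
  apply/asboolP; exists (mk_sub Sp2v); last by rewrite Sp2_mulA.
  by exists v, 1; rewrite quat_conj1 mulr1.
have e1 : u + v = s by rewrite /u /v; field.
have e2 : u - v = t by rewrite /u /v; field.
have e1' : u' + v = s' by rewrite /u' /v d; field.
have e2' : u' - v = t' by rewrite /u' /v d; field.
rewrite -e1 -e2 in r; rewrite -e1' -e2' in r'.
apply: CP3_rel_col; rewrite /= mulmx2E mulmx2E ?mulmx2E !mxE /=.
  move/expi_mul_rotated: r => ->.
  by rewrite !(mulr0, mul0r, addr0, add0r) mulrA.
move/expi_mul_rotated: r' => ->.
by rewrite !(mulr0, mul0r, addr0, add0r) mulrA.
Qed.
End Invariants.

(** * General topology: compact to Hausdorff bijections and continuity criteria *)

Section Topology.
Context {T U : topologicalType}.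

(** The map is closed: closed sets of a compact space are compact, and so are their images, which
    are then closed in a Hausdorff space. *)
Lemma compact_hausdorff_homeomorphic (f : T -> U) : compact [set: T] ->
  hausdorff_space U -> continuous f -> injective f ->
  (forall y, exists x, f x = y) -> homeomorphic T U.
Proof.
move=> cT hU cf injf surjf; have [g fg] := choice surjf.
have gf : cancel f g by move=> x; apply: injf; rewrite fg.
exists f, g; split => //; apply/continuous_closedP => A clA.
suff -> : g @^-1` A = f @` A.
  apply: compact_closed => //; apply: continuous_compact.
    exact: continuous_subspaceT.
  exact: subclosed_compact clA cT _.
apply/seteqP; split => [y Ay|_ [x Ax <-]] /=; last by rewrite gf.
by exists (g y) => //; rewrite fg.
Qed.

Lemma hausdorff_inj (f : T -> U) : hausdorff_space U -> continuous f ->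
  injective f -> hausdorff_space T.
Proof.
move=> hU cf injf x y xy; apply/injf/hU => A B nA nB.
by have [z [Az Bz]] := xy _ _ (cf x A nA) (cf y B nB); exists (f z).
Qed.

Lemma homeomorphic_sym : homeomorphic T U -> homeomorphic U T.
Proof. by move=> [f [g [cf cg fg gf]]]; exists g, f. Qed.

(** Stated for entries in any topological space, so as to cover quaternionic matrices. *)
Lemma mx_entry_continuous m n (i : 'I_m) (j : 'I_n) :
  continuous (fun M : 'M[T]_(m, n) => M i j).
Proof.
move=> M A nA; exists (fun i' j' => if (i' == i) && (j' == j) then A else setT).
  move=> i' j'; case: ifPn => [/andP[/eqP -> /eqP ->]//|_]; exact: filterT.
by move=> N /(_ i j); rewrite !eqxx.
Qed.

Lemma continuous_mx m n (f : U -> 'M[T]_(m, n)) :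
  (forall i j, continuous (fun x => f x i j)) -> continuous f.
Proof.
move=> cf x A [P nP PA]; apply: filterS PA _.
apply: filter_forall => i; apply: filter_forall => j.
exact: cf (nP i j).
Qed.
End Topology.

Lemma continuous_val_set (T U : topologicalType) (A : set T) (f : U -> A) :
  continuous (fun x => \val (f x) : T) -> continuous f.
Proof. exact: continuous_comp_initial. Qed.

Lemma continuous_pair (T U V : topologicalType) (f : T -> U) (g : T -> V) :
  continuous f -> continuous g -> continuous (fun x => (f x, g x)).
Proof. by move=> cf cg x; apply: (cvg_pair (cf x) (cg x)). Qed.

Lemma continuous_fst (T U V : topologicalType) (f : T -> U * V) :
  continuous f -> continuous (fun x => (f x).1).
Proof. by move=> cf x; apply: (cvg_comp _ _ (cf x)); exact: cvg_fst. Qed.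

Lemma continuous_snd (T U V : topologicalType) (f : T -> U * V) :
  continuous f -> continuous (fun x => (f x).2).
Proof. by move=> cf x; apply: (cvg_comp _ _ (cf x)); exact: cvg_snd. Qed.

(** * Continuity of the quaternion coordinates and of the invariants *)

Section QuatTopology.
Context {R : realType}.

Lemma continuous_quat (U : topologicalType) (f : U -> quat R) :
  continuous (fun x => qr (f x)) -> continuous (fun x => qi (f x)) ->
  continuous (fun x => qj (f x)) -> continuous (fun x => qk (f x)) ->
  continuous f.
Proof.
move=> cr ci cj ck; apply: (@continuous_comp_initial _ _ _ (@quat_coords R)).
by do 3![apply: continuous_pair => //].
Qed.

Lemma quat_coords_continuous : continuous (@quat_coords R : quat R -> _).
Proof. exact: initial_continuous. Qed.

Lemma qr_continuous : continuous (@qr R : quat R -> R).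
Proof. exact: continuous_fst (continuous_fst (continuous_fst quat_coords_continuous)). Qed.

Lemma qi_continuous : continuous (@qi R : quat R -> R).
Proof. exact: continuous_snd (continuous_fst (continuous_fst quat_coords_continuous)). Qed.

Lemma qj_continuous : continuous (@qj R : quat R -> R).
Proof. exact: continuous_snd (continuous_fst quat_coords_continuous). Qed.

Lemma qk_continuous : continuous (@qk R : quat R -> R).
Proof. exact: continuous_snd quat_coords_continuous. Qed.

Lemma Sp2_entry_continuous (i j : 'I_2) : continuous (fun p : Sp2 R => \val p i j).
Proof.
move=> p; apply: (@continuous_comp _ _ _ (fun p : Sp2 R => \val p) (fun M => M i j)).
  exact: initial_continuous.
exact: mx_entry_continuous.
Qed.

Lemma Sp2_inv5_continuous : continuous (@Sp2_inv5 R).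
Proof.
have cr := qr_continuous; have ci := qi_continuous.
have cj := qj_continuous; have ck := qk_continuous.
have cz : continuous (@z_norm R : quat R -> R).
  by move=> x; exact: (cvgD (cvgM (cr x) (cr x)) (cvgM (ci x) (ci x))).
have cw : continuous (@w_norm R : quat R -> R).
  by move=> x; exact: (cvgD (cvgM (cj x) (cj x)) (cvgM (ck x) (ck x))).
have cre : continuous (@tw_re R : quat R -> R).
  by move=> x; exact: (cvgD (cvgM (cr x) (cj x)) (cvgM (ci x) (ck x))).
have cim : continuous (@tw_im R : quat R -> R).
  by move=> x; exact: (cvgB (cvgM (cr x) (ck x)) (cvgM (ci x) (cj x))).
have c (q : quat R -> R) i j : continuous q -> continuous (fun p : Sp2 R => q (\val p i j)).
  by move=> cq p; apply: (cvg_comp _ _ (@Sp2_entry_continuous i j p)); exact: cq.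
apply: continuous_pair; last first.
  move=> p; exact: (cvgD (cvgM (c _ 0 0 cre p) (c _ 1 0 cre p))
                         (cvgM (c _ 0 0 cim p) (c _ 1 0 cim p))).
apply: continuous_pair; last exact: c.
apply: continuous_pair; last exact: c.
by apply: continuous_pair; exact: c.
Qed.

End QuatTopology.

(** * Frames from real vectors, and their invariants *)

Section RealSection.
Context {R : realType}.
Implicit Types (x y : nonzero4 R) (p q : Sp2 R).

(** If the signs relating the two quadruples have odd parity, the product equals its own opposite,
    so some coordinate is zero and its sign can be flipped to restore even parity. *)
Lemma even_signs (x0 x1 x2 x3 y0 y1 y2 y3 : R) :
  y0 ^+ 2 = x0 ^+ 2 -> y1 ^+ 2 = x1 ^+ 2 -> y2 ^+ 2 = x2 ^+ 2 ->
  y3 ^+ 2 = x3 ^+ 2 -> y0 * y1 * y2 * y3 = x0 * x1 * x2 * x3 ->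
  exists e0 e1 e2 : bool, [/\ y0 = (-1) ^+ e0 * x0, y1 = (-1) ^+ e1 * x1,
    y2 = (-1) ^+ e2 * x2 & y3 = (-1) ^+ (e0 (+) e1 (+) e2) * x3].
Proof.
have sgn (u v : R) : v ^+ 2 = u ^+ 2 -> exists e : bool, v = (-1) ^+ e * u.
  move=> /eqP; rewrite eqf_sqr => /orP[/eqP ->|/eqP ->].
    by exists false; rewrite expr0 mul1r.
  by exists true; rewrite expr1 mulN1r.
move=> /sgn[e0 ->] /sgn[e1 ->] /sgn[e2 ->] /sgn[e3 ->] prod.
have [->|e3N] := eqVneq e3 (e0 (+) e1 (+) e2); first by exists e0, e1, e2.
have {e3N} e3E : e3 = ~~ (e0 (+) e1 (+) e2) by case: e0 e1 e2 e3 e3N {prod} => [] [] [] [].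
have : x0 * x1 * x2 * x3 == 0.
  suff : (x0 * x1 * x2 * x3) *+ 2 == 0 by rewrite mulrn_eq0.
  rewrite mulr2n -[X in X + _]prod e3E; apply/eqP.
  by case: e0 e1 e2 {e3E prod} => [] [] []; rewrite /= ?expr0 ?expr1; ring.
rewrite !mulf_eq0 -!orbA => /or4P[] /eqP z0; rewrite z0 !mulr0.
- exists (~~ e0), e1, e2; rewrite !mulr0 e3E; split => //.
  by case: e0 e1 e2 {e3E prod} => [] [] [].
- exists e0, (~~ e1), e2; rewrite !mulr0 e3E; split => //.
  by case: e0 e1 e2 {e3E prod} => [] [] [].
- exists e0, e1, (~~ e2); rewrite !mulr0 e3E; split => //.
  by case: e0 e1 e2 {e3E prod} => [] [] [].
- by exists e0, e1, e2; rewrite !mulr0.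
Qed.

Definition i0 : 'I_4 := @Ordinal 4 0 isT.
Definition i1 : 'I_4 := @Ordinal 4 1 isT.
Definition i2 : 'I_4 := @Ordinal 4 2 isT.
Definition i3 : 'I_4 := @Ordinal 4 3 isT.

Lemma row4P (u v : 'rV[R]_4) : u 0 i0 = v 0 i0 -> u 0 i1 = v 0 i1 ->
  u 0 i2 = v 0 i2 -> u 0 i3 = v 0 i3 -> u = v.
Proof.
move=> e0 e1 e2 e3; apply/rowP => -[[|[|[|[|//]]]] k];
  [move: e0|move: e1|move: e2|move: e3]; congr (_ = _); congr (_ _ _); exact: val_inj.
Qed.

Definition sqnorm4 (u : 'rV[R]_4) : R :=
  u 0 i0 ^+ 2 + u 0 i1 ^+ 2 + u 0 i2 ^+ 2 + u 0 i3 ^+ 2.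

Lemma sqnorm4_ge0 u : 0 <= sqnorm4 u.
Proof. by rewrite /sqnorm4 !addr_ge0 ?sqr_ge0. Qed.

Lemma sqnorm4_gt0 x : 0 < sqnorm4 (\val x).
Proof.
rewrite lt_def sqnorm4_ge0 andbT; apply: contra_notN (elimN eqP (set_valP x)) => /eqP.
rewrite /sqnorm4 => /eqP; rewrite !paddr_eq0 ?addr_ge0 ?sqr_ge0 // !sqrf_eq0.
by move=> /andP[/andP[/andP[/eqP e0 /eqP e1] /eqP e2] /eqP e3]; apply: row4P; rewrite ?mxE.
Qed.

Definition normalized (u : 'rV[R]_4) (i : 'I_4) : R := u 0 i / Num.sqrt (sqnorm4 u).

(* All entries lie in the commutative subfield R + R j of H. *)
Definition real_frame (u : 'rV[R]_4) : 'M[quat R]_2 :=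
  mx2 (Quat (normalized u i0) 0 (normalized u i2) 0)
      (Quat (- normalized u i1) 0 (normalized u i3) 0)
      (Quat (normalized u i1) 0 (normalized u i3) 0)
      (Quat (normalized u i0) 0 (- normalized u i2) 0).

Lemma normalized_sqr x : normalized (\val x) i0 ^+ 2 + normalized (\val x) i1 ^+ 2
  + normalized (\val x) i2 ^+ 2 + normalized (\val x) i3 ^+ 2 = 1.
Proof.
rewrite /normalized !expr_div_n sqr_sqrtr ?sqnorm4_ge0 // -!mulrDl.
by rewrite divff // gt_eqF // sqnorm4_gt0.
Qed.

Lemma real_frame_Sp2 x : Sp2 R (real_frame (\val x)).
Proof.
have := normalized_sqr x; rewrite /real_frame.
move: (normalized _ i0) (normalized _ i1) (normalized _ i2) (normalized _ i3).
move=> a b c d e; split; apply: mx2P;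
  rewrite mulmx2E !adjE !mxE /=; apply: quat_eqP => /=; rewrite -?e; ring.
Qed.

Definition real_section x : Sp2 R := mk_sub (real_frame_Sp2 x).

Lemma nu_real_section x : nu (real_section x) = 0.
Proof. by rewrite nuE /tw_im /= !mxE /=; ring. Qed.

(** Coordinates [i0] and [i2] form the upper entry of the first column, [i1] and [i3] the lower one,
    whence the order of the squares. *)
Lemma real_section_inv5 x : let N := sqnorm4 (\val x) in
  let u := \val x in
  Sp2_inv5 (real_section x) =
  (u 0 i0 ^+ 2 / N, u 0 i2 ^+ 2 / N, u 0 i1 ^+ 2 / N, u 0 i3 ^+ 2 / N,
   u 0 i0 * u 0 i1 * u 0 i2 * u 0 i3 / N ^+ 2).
Proof.
move=> N u; have N2 : Num.sqrt N ^+ 2 = N by rewrite sqr_sqrtr ?sqnorm4_ge0.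
rewrite /Sp2_inv5 /col_inv /z_norm /w_norm /tw_re /tw_im /= !mxE /=.
rewrite /normalized -/N -/u.
have s0 : Num.sqrt N != 0 by rewrite sqrtr_eq0 -ltNge sqnorm4_gt0.
move: (Num.sqrt N) N2 s0 => n <- s0.
by congr (_, _, _, _, _); field.
Qed.

Lemma RP3_orbit_inv5 x y :
  Sp2_inv5 (real_section x) = Sp2_inv5 (real_section y) <->
  RP3_orbit_rel (\pi_(RP3 R) x) (\pi_(RP3 R) y).
Proof.
rewrite !real_section_inv5; have Nx := sqnorm4_gt0 x; have Ny := sqnorm4_gt0 y.
split.
  set u := \val x in Nx *; set v := \val y in Ny *.
  move=> [e0 e2 e1 e3 e].
  (* The factor that gives [u] the length of [v]. *)
  pose c := Num.sqrt (sqnorm4 v / sqnorm4 u).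
  have c2 : c ^+ 2 = sqnorm4 v / sqnorm4 u by rewrite sqr_sqrtr // divr_ge0 ?ltW.
  have nx := lt0r_neq0 Nx; have ny := lt0r_neq0 Ny.
  have c0 : c != 0 by rewrite -sqrf_eq0 c2 mulf_neq0 ?invr_eq0.
  have sc (s t : R) : s ^+ 2 / sqnorm4 u = t ^+ 2 / sqnorm4 v -> t ^+ 2 = (c * s) ^+ 2.
    by move=> h; rewrite exprMn c2 mulrAC -mulrA h; field.
  have [||||| f0 [f1 [f2 [g0 g1 g2 g3]]]] := @even_signs (c * u 0 i0) (c * u 0 i1)
      (c * u 0 i2) (c * u 0 i3) (v 0 i0) (v 0 i1) (v 0 i2) (v 0 i3);
    try exact: sc.
    transitivity ((c ^+ 2) ^+ 2 * (u 0 i0 * u 0 i1 * u 0 i2 * u 0 i3)); last by ring.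
    rewrite c2 expr_div_n [RHS]mulrAC -[RHS]mulrA e; field.
    by rewrite ny.
  (* Taking the common sign of [f0] out into the scalar leaves the signs 0, f0 + f1, f0 + f2 and f1
     + f2 mod 2, the pattern of [Z22_sign]. *)
  apply/asboolP; exists (f0 (+) f1, f0 (+) f2); rewrite Z22_actE.
  apply/esym/RP3P/asboolP; exists ((-1) ^+ f0 * c).
    by rewrite mulf_neq0 // signr_eq0.
  apply: row4P; rewrite /= !mxE /= -/u -/v ?g0 ?g1 ?g2 ?g3.
  - by rewrite expr0 mul1r mulrA.
  - by rewrite signr_addb; case: (f0) (f1) => [] []; rewrite ?expr0 ?expr1; ring.
  - by rewrite signr_addb; case: (f0) (f2) => [] []; rewrite ?expr0 ?expr1; ring.
  - by rewrite !signr_addb; case: (f0) (f1) (f2) => [] [] []; rewrite ?expr0 ?expr1; ring.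
move=> /asboolP[s]; rewrite Z22_actE => /esym/RP3P/asboolP[c c0 e].
have sq (b : bool) (r : R) : ((-1) ^+ b * r) ^+ 2 = r ^+ 2.
  by rewrite exprMn sqrr_sign mul1r.
set u := \val x in Nx *; set v := \val y in Ny *.
have {}e : v = c *: Z22_mulrow s u by [].
have E i : v 0 i ^+ 2 = c ^+ 2 * u 0 i ^+ 2 by rewrite e !mxE exprMn sq.
have Nv : sqnorm4 v = c ^+ 2 * sqnorm4 u by rewrite /sqnorm4 !E; ring.
(* An even number of sign changes leaves the product alone, so only c^4 remains. *)
have P : v 0 i0 * v 0 i1 * v 0 i2 * v 0 i3 =
    (c ^+ 2) ^+ 2 * (u 0 i0 * u 0 i1 * u 0 i2 * u 0 i3).
  rewrite e !mxE /Z22_sign /= signr_addb.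
  by case: s {e} => [] [] []; rewrite /= ?expr0 ?expr1; ring.
have nx := lt0r_neq0 Nx.
rewrite Nv P !E; congr (_, _, _, _, _); field; by rewrite nx c0.
Qed.

Lemma real_section_surj p : nu p = 0 ->
  exists x, Sp2_inv5 (real_section x) = Sp2_inv5 p.
Proof.
have n12 : 12 != 0 :> R by rewrite pnatr_eq0.
rewrite nuE => /eqP; rewrite mulf_eq0 (negPf n12) /= => /eqP im0.
have [_ /matrixP/(_ 0 0)] := set_valP p.
rewrite mulmx2E !adjE [RHS]mxE /= => /(congr1 (@qr R)) /= unit.
have : Sp2_inv5 p = col_inv (\val p 0 0) (\val p 1 0) by [].
move: (\val p 0 0) (\val p 1 0) im0 unit => a b im0 unit ->.
set r := tw_re a * tw_re b + tw_im a * tw_im b.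
have r2 : r ^+ 2 = z_norm a * w_norm a * (z_norm b * w_norm b).
  rewrite [RHS](_ : _ = r ^+ 2 + (tw_im a * tw_re b - tw_re a * tw_im b) ^+ 2).
    by rewrite im0 expr0n addr0.
  by rewrite /r /z_norm /w_norm /tw_re /tw_im; ring.
have [za wa] : 0 <= z_norm a /\ 0 <= w_norm a by rewrite !addr_ge0 ?sqr_ge0.
have [zb wb] : 0 <= z_norm b /\ 0 <= w_norm b by rewrite !addr_ge0 ?sqr_ge0.
(* The moduli of the four complex coordinates. Since r^2 is the product of their squares, giving one
   of them the sign of [r] makes their product equal to [r]. *)
pose l := [:: (-1) ^+ (r < 0)%R * Num.sqrt (z_norm a); Num.sqrt (z_norm b);
              Num.sqrt (w_norm a); Num.sqrt (w_norm b)].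
pose u : 'rV[R]_4 := \row_i nth 0 l i.
have u0 : u 0 i0 ^+ 2 = z_norm a.
  by rewrite mxE /= exprMn sqrr_sign mul1r sqr_sqrtr.
have u1 : u 0 i1 ^+ 2 = z_norm b by rewrite mxE /= sqr_sqrtr.
have u2 : u 0 i2 ^+ 2 = w_norm a by rewrite mxE /= sqr_sqrtr.
have u3 : u 0 i3 ^+ 2 = w_norm b by rewrite mxE /= sqr_sqrtr.
have N1 : sqnorm4 u = 1.
  by rewrite /sqnorm4 u0 u1 u2 u3 -[RHS]unit /z_norm /w_norm; ring.
have nu : nonzero4 R u.
  apply/eqP => u00; move/eqP: N1; rewrite /sqnorm4 u00 !mxE !expr0n !addr0.
  by rewrite eq_sym oner_eq0.
exists (mk_sub nu); rewrite real_section_inv5 /= N1 u0 u1 u2 u3.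
rewrite expr1n !divr1 /col_inv; congr (_, _, _, _, _); rewrite -/r.
rewrite !mxE /= -!mulrA -!sqrtrM ?mulr_ge0 //.
rewrite (_ : _ * (_ * _) = r ^+ 2); last by rewrite r2; ring.
by rewrite sqrtr_sqr -numEsign.
Qed.
End RealSection.

(** * The invariants embed the orbit space of the zero level continuously in R^5 *)

Section NuOrbitSpace.
Context {R : realType}.
Implicit Types (p q : Sp2 R).

Lemma CP3_rel_inv5 p q : CP3_rel p q -> Sp2_inv5 p = Sp2_inv5 q.
Proof.
move=> /asboolP[h hH ->].
by rewrite -[Sp2_mul p h]Sp2_mul1 torus_act_inv5 //; exact: T2_1.
Qed.

Definition CP3_inv5 (z : CP3 R) : R * R * R * R * R := Sp2_inv5 (repr z).

Lemma CP3_inv5E p : CP3_inv5 (\pi_(CP3 R) p) = Sp2_inv5 p.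
Proof. by apply: CP3_rel_inv5; apply/CP3P; rewrite reprK. Qed.

Lemma CP3_inv5_T2 (t : T2 R) (z : CP3 R) : CP3_inv5 (T2_act t z) = CP3_inv5 z.
Proof.
rewrite /T2_act CP3_inv5E -[repr z]Sp2_mulr1 torus_act_inv5 ?Sp2_mulr1 //.
  exact: set_valP.
exact: Sp1U1_1.
Qed.

Lemma CP3_inv5_continuous : continuous CP3_inv5.
Proof.
apply/quotient_continuous; rewrite (_ : _ \o _ = @Sp2_inv5 R).
  exact: Sp2_inv5_continuous.
by apply/funext => p; exact: CP3_inv5E.
Qed.

Lemma nu_orbitP (x y : nu_zero R) :
  reflect (\pi_(nu_zero_mod_T2 R) x = \pi_(nu_zero_mod_T2 R) y) (nu_orbit_rel x y).
Proof. exact: (@eqmodP _ (@nu_orbit_equiv R) x y). Qed.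

Definition nu_orbit_inv5 (y : nu_zero_mod_T2 R) : R * R * R * R * R :=
  CP3_inv5 (\val (repr y)).

Lemma nu_orbit_inv5E (z : nu_zero R) :
  nu_orbit_inv5 (\pi_(nu_zero_mod_T2 R) z) = CP3_inv5 (\val z).
Proof.
have /asboolP[t e] : nu_orbit_rel z (repr (\pi_(nu_zero_mod_T2 R) z)).
  by apply/nu_orbitP; rewrite reprK.
by rewrite /nu_orbit_inv5 e CP3_inv5_T2.
Qed.

Lemma nu_orbit_inv5_continuous : continuous nu_orbit_inv5.
Proof.
apply/quotient_continuous.
rewrite (_ : _ \o _ = fun z : nu_zero R => CP3_inv5 (\val z)).
  move=> z; apply: (@continuous_comp _ _ _ (fun z : nu_zero R => \val z) CP3_inv5).
    exact: initial_continuous.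
  exact: CP3_inv5_continuous.
by apply/funext => z; exact: nu_orbit_inv5E.
Qed.

Lemma nu_orbit_inv5_inj : injective nu_orbit_inv5.
Proof.
move=> x y e; rewrite -[x]reprK -[y]reprK; apply/nu_orbitP/asboolP.
have nu0 (z : nu_zero R) : nu (repr (\val z)) = 0.
  by rewrite -nu_CP3E reprK; exact: set_valP z.
have [t tp] := inv5_torus_orbit (nu0 _) (nu0 _) e.
by exists t; rewrite -[LHS]reprK; apply/esym/CP3P.
Qed.

End NuOrbitSpace.

(** * Compactness of the real quotient and the map between the orbit spaces *)

Section Comparison.
Context {R : realType}.
Implicit Types (x y : nonzero4 R).

Definition RP3_orbit x : RP3_mod_Z22 R := \pi_(RP3_mod_Z22 R) (\pi_(RP3 R) x).

Lemma RP3_orbit_repr (y : RP3_mod_Z22 R) : RP3_orbit (repr (repr y)) = y.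
Proof. by rewrite /RP3_orbit !reprK. Qed.

Lemma RP3_mod_Z22P (x y : RP3 R) :
  reflect (\pi_(RP3_mod_Z22 R) x = \pi_(RP3_mod_Z22 R) y) (RP3_orbit_rel x y).
Proof. exact: (@eqmodP _ (@RP3_orbit_equiv R) x y). Qed.

Lemma RP3_orbitP x y :
  RP3_orbit x = RP3_orbit y <-> Sp2_inv5 (real_section x) = Sp2_inv5 (real_section y).
Proof.
by split => [/RP3_mod_Z22P/RP3_orbit_inv5|/RP3_orbit_inv5/RP3_mod_Z22P].
Qed.

Lemma RP3_orbit_continuous : continuous RP3_orbit.
Proof. by move=> x; apply: (cvg_comp _ _ (@pi_continuous _ _ x)); exact: pi_continuous. Qed.

Lemma ones_neq0 : nonzero4 R (const_mx 1).
Proof. by apply/eqP => /rowP/(_ 0); rewrite !mxE => /eqP; rewrite oner_eq0. Qed.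

Lemma RP3_mod_Z22_compact : compact [set: RP3_mod_Z22 R].
Proof.
(* The norm on row vectors is the maximum norm, so [S] is the boundary of a cube; it is compact and
   meets every line through the origin. *)
pose S : set 'rV[R]_4 := [set u | `|u| = 1].
have S0 u : S u -> nonzero4 R u.
  by move=> Su; apply/eqP => u0; move: Su; rewrite /S /= u0 normr0 => /esym/eqP; rewrite oner_eq0.
have cS : compact S.
  apply: bounded_closed_compact.
    by exists 1; split => // M M1 u /= ->; exact: ltW.
  apply: (@preimage_closed _ _ (fun u : 'rV[R]_4 => `|u|) [set 1]).
    by move=> u _; exact: (@norm_continuous _ 'rV[R]_4).
  exact: closed_eq.
(* [RP3_orbit] extended to all row vectors, with the orbit of (1, 1, 1, 1) as default value at 0, a
   point outside [S]. *)
pose f := valL_ (RP3_orbit (mk_sub ones_neq0)) RP3_orbit.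
have cf : {within S, continuous f}.
  apply: (@continuous_subspaceW _ _ _ (nonzero4 R)); first exact: S0.
  exact/subspace_valL_continuousP'/RP3_orbit_continuous.
have -> : [set: RP3_mod_Z22 R] = f @` S.
  apply/seteqP; split => // y _; rewrite -(RP3_orbit_repr y).
  move: (repr (repr y)) => {y} x.
  have n0 : `|\val x| != 0 by rewrite normr_eq0; exact: set_valP x.
  have z0 : nonzero4 R (`|\val x|^-1 *: \val x).
    by rewrite /nonzero4 /= scaler_eq0 invr_eq0 (negPf n0); exact: set_valP x.
  exists (\val (mk_sub z0)).
    by rewrite /S /= normrZ normfV normr_id mulVf.
  rewrite [LHS](congr1 (fun g => g (mk_sub z0)) (valLK _ RP3_orbit)).
  rewrite /RP3_orbit; congr (\pi_(RP3_mod_Z22 R) _); apply/RP3P/asboolP.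
  by exists `|\val x| => //=; rewrite scalerA divff ?scale1r.
exact: continuous_compact.
Qed.

Lemma real_section_nu_zero x : nu_zero R (\pi_(CP3 R) (real_section x)).
Proof. by rewrite /nu_zero /= nu_CP3E nu_real_section. Qed.

Definition real_orbit x : nu_zero_mod_T2 R :=
  \pi_(nu_zero_mod_T2 R) (mk_sub (real_section_nu_zero x)).

Lemma real_orbit_inv5 x : nu_orbit_inv5 (real_orbit x) = Sp2_inv5 (real_section x).
Proof. by rewrite nu_orbit_inv5E CP3_inv5E. Qed.

Lemma real_section_continuous : continuous (@real_section R).
Proof.
apply: continuous_val_set; apply: continuous_mx => i j.
have cc (k : 'I_4) : continuous (fun x : nonzero4 R => \val x 0 k : R).
  move=> x; apply: (@continuous_comp _ _ _ (fun z : nonzero4 R => \val z) (fun u => u 0 k)).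
    exact: initial_continuous.
  exact: coord_continuous.
have cN : continuous (fun x : nonzero4 R => sqnorm4 (\val x)).
  have c2 k : continuous (fun x : nonzero4 R => \val x 0 k ^+ 2 : R).
    by move=> x; exact: (cvgM (cc k x) (cc k x)).
  by move=> x; exact: (cvgD (cvgD (cvgD (c2 i0 x) (c2 i1 x)) (c2 i2 x)) (c2 i3 x)).
have cn (k : 'I_4) : continuous (fun x : nonzero4 R => normalized (\val x) k).
  have s0 x : Num.sqrt (sqnorm4 (\val x)) != 0 by rewrite sqrtr_eq0 -ltNge sqnorm4_gt0.
  have cs : continuous (fun x : nonzero4 R => Num.sqrt (sqnorm4 (\val x))).
    by move=> x; exact: (continuous_comp (cN x) (@sqrt_continuous _ _)).
  by move=> x; exact: (cvgM (cc k x) (cvgV (s0 x) (cs x))).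
have cNn (k : 'I_4) : continuous (fun x : nonzero4 R => - normalized (\val x) k).
  by move=> x; exact: (cvgN (cn k x)).
have c0 : continuous (fun _ : nonzero4 R => 0 : R) by exact: cst_continuous.
rewrite (_ : (fun x => _) = fun x : nonzero4 R => real_frame (\val x) i j); last exact/funext.
rewrite /real_frame /mx2.
under eq_fun do rewrite mxE.
by case: (i == 0); case: (j == 0); apply: continuous_quat => /=.
Qed.

Lemma real_orbit_continuous : continuous real_orbit.
Proof.
move=> x; apply: (@continuous_comp _ _ _ (fun x => mk_sub (real_section_nu_zero x))
    (\pi_(nu_zero_mod_T2 R))); last exact: pi_continuous.
apply: (@continuous_val_set _ _ (nu_zero R)) x => x /=.
apply: (@continuous_comp _ _ _ (@real_section R) (\pi_(CP3 R))).
  exact: real_section_continuous.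
exact: pi_continuous.
Qed.

End Comparison.

(** * The homeomorphism *)

Theorem proposition5p2 (R : realType) :
  homeomorphic (nu_zero_mod_T2 R) (RP3_mod_Z22 R).
Proof.
pose f (y : RP3_mod_Z22 R) := real_orbit (repr (repr y)).
have f_inv5 y : nu_orbit_inv5 (f y) = Sp2_inv5 (real_section (repr (repr y))).
  exact: real_orbit_inv5.
(* The representatives chosen in [f] are immaterial, so its continuity can be tested on nonzero
   vectors. *)
have fE x : f (RP3_orbit x) = real_orbit x.
  apply: nu_orbit_inv5_inj; rewrite f_inv5 real_orbit_inv5.
  by apply/RP3_orbitP; rewrite RP3_orbit_repr.
apply: homeomorphic_sym; apply: (@compact_hausdorff_homeomorphic _ _ f).
- exact: RP3_mod_Z22_compact.
- apply: hausdorff_inj nu_orbit_inv5_continuous nu_orbit_inv5_inj.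
  exact: (@norm_hausdorff R).
(* One use for each of the two nested quotients, by sign changes and by scalars. *)
- apply/quotient_continuous/quotient_continuous.
  rewrite (_ : _ \o _ = @real_orbit R); last exact/funext.
  exact: real_orbit_continuous.
- move=> y y' e; rewrite -[y]RP3_orbit_repr -[y']RP3_orbit_repr.
  by apply/RP3_orbitP; rewrite -!f_inv5 e.
- move=> z; have z0 : nu (repr (\val (repr z))) = 0.
    by rewrite -nu_CP3E reprK; exact: set_valP (repr z).
  have [x xz] := real_section_surj z0.
  by exists (RP3_orbit x); apply: nu_orbit_inv5_inj; rewrite fE real_orbit_inv5.
Qed.
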